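(* Let $\mathbb{F}$ be any field. There is, up to isomorphism, a unique nilpotent symplectic alternating algebra $L$ over $\mathbb{F}$ of dimension $10$ that has isotropic center of dimension $5$. $L$ can be described by the nilpotent presentation $$\mathcal{P}_{10}^{(5,1)}:\quad (y_1y_2,y_3)=1,\ (y_1y_4,y_5)=1.$$
   Context: A symplectic alternating algebra (SAA) over a field $\mathbb{F}$ is a finite-dimensional vector space $L$ over $\mathbb{F}$ with a non-degenerate alternating bilinear form $(\ ,\ )$ and a bilinear product $\cdot$ satisfying $u\cdot u=0$ for all $u$ and $(u\cdot v,w)=(v\cdot w,u)$ for all $u,v,w\in L$. No associativity or Jacobi identity is assumed. The map $(u,v,w)\mapsto(uv,w)$ is then an alternating trilinear form. A standard basis (in dimension $10$) is a basis $x_1,y_1,\ldots,x_5,y_5$ with $(x_i,x_j)=(y_i,y_j)=0$ and $(x_i,y_j)=\delta_{ij}$ for all $i,j$. Presentations: $L$ is described by a presentation if there is a standard basis for which the listed values of triples $(uv,w)$ hold and $(uv,w)=0$ for all triples of basis elements that are not a reordering of a listed one. Isomorphisms are linear bijections preserving product and form. $L^1=L$, $L^{m+1}=L^mL$ (span of products). $L$ is nilpotent if $L^{m+1}=\{0\}$ for some $m\ge 0$. The center is $Z(L)=\{x\in L: xL=\{0\}\}$; it is isotropic if $(u,v)=0$ for all $u,v\in Z(L)$. *)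

(* Defs.v *)
From mathcomp Require Import all_boot all_order all_algebra.

Set Implicit Arguments.
Unset Strict Implicit.
Unset Printing Implicit Defensive.

Import GRing.Theory.

Local Open Scope ring_scope.

(* Symplectic alternating algebras over F. *)
Record saa (F : fieldType) := Saa {
  saa_space :> vectType F;
  saa_form : {biscalar saa_space};
  saa_mul : {bilinear saa_space -> saa_space -> saa_space};
  form_alternating : forall u, saa_form u u = 0;
  form_nondegenerate : forall u, (forall v, saa_form u v = 0) -> u = 0;
  mul_alternating : forall u, saa_mul u u = 0;
  form_mul_cyclic : forall u v w, saa_form (saa_mul u v) w = saa_form (saa_mul v w) u
}.

Arguments saa_form {F s}.
Arguments saa_mul {F s}.

Section Algebra.

Variables (F : fieldType) (L : saa F).
Implicit Types (U V W : {vspace L}) (u v x : L).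

(* The span of all products; bases suffice by bilinearity (see prodsP). *)
Definition prods U V : {vspace L} :=
  <<allpairs (@saa_mul F L) (vbasis U) (vbasis V)>>%VS.

Lemma mem_prods U V u v : u \in U -> v \in V -> saa_mul u v \in prods U V.
Proof.
move=> /coord_vbasis -> /coord_vbasis ->.
rewrite linear_sumlz; apply: memv_suml => i _.
rewrite linear_sumr; apply: memv_suml => j _.
rewrite linearZl_LR linearZr_LR /= !memvZ // memv_span //.
by apply: allpairs_f; apply: mem_nth; rewrite size_tuple.
Qed.

Lemma prodsP U V W :
  reflect (forall u v, u \in U -> v \in V -> saa_mul u v \in W) (prods U V <= W)%VS.
Proof.
apply: (iffP idP) => [sUVW u v Uu Vv | sUVW].
  exact: (subvP sUVW) (mem_prods Uu Vv).
by apply/span_subvP => _ /allpairsP[[u v] /= [Uu Vv ->]]; apply: sUVW; exact: vbasis_mem.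
Qed.

(* The indices are shifted by one: lpow m is L^(m+1). *)
Fixpoint lpow (m : nat) : {vspace L} :=
  if m is m'.+1 then prods (lpow m') fullv else fullv.

Definition saa_nilpotent : Prop := exists m, lpow m = 0%VS.

(* As with prods, a basis of L suffices (see centerP). *)
Definition saa_center : {vspace L} :=
  (\bigcap_(i < \dim (fullv : {vspace L}))
     lker (linfun (applyr (@saa_mul F L) (vbasis (fullv : {vspace L}))`_i)))%VS.

Lemma centerP x : reflect (forall u, saa_mul x u = 0) (x \in saa_center).
Proof.
apply: (iffP idP) => [Zx u | Zx].
  rewrite (coord_vbasis (memvf u)) linear_sumr big1 // => i _.
  rewrite linearZr_LR /=; move/subv_bigcapP: Zx => /(_ i isT).
  by rewrite -memvE memv_ker lfunE /= /applyr => /eqP ->; rewrite scaler0.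
apply/subv_bigcapP => i _; rewrite -memvE memv_ker lfunE /=.
by apply/eqP; exact: Zx.
Qed.

Definition isotropic V : Prop := forall u v, u \in V -> v \in V -> saa_form u v = 0.

End Algebra.

Definition saa_isom (F : fieldType) (L M : saa F) : Prop :=
  exists f : 'Hom(L, M),
    [/\ bijective f,
        forall u v, f (saa_mul u v) = saa_mul (f u) (f v)
      & forall u v, saa_form (f u) (f v) = saa_form u v].

(* The index inl i stands for x_i and inr i for y_i. *)
Definition std_index (n : nat) : finType := ('I_n + 'I_n)%type.

Definition standard_basis (F : fieldType) (L : saa F) (n : nat)
    (b : std_index n -> L) : Prop :=
  [/\ basis_of fullv (codom b),
      forall i j, saa_form (b (inl i)) (b (inl j)) = 0,
      forall i j, saa_form (b (inr i)) (b (inr j)) = 0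
    & forall i j, saa_form (b (inl i)) (b (inr j)) = (i == j)%:R].

(* An entry (i, j, k, a) lists the value (b_i b_j, b_k) = a. *)
Definition presentation (F : fieldType) (n : nat) :=
  seq (std_index n * std_index n * std_index n * F).

Definition described_by (F : fieldType) (L : saa F) (n : nat)
    (P : presentation F n) : Prop :=
  exists b : std_index n -> L,
    [/\ standard_basis b,
        forall i j k a, (i, j, k, a) \in P -> saa_form (saa_mul (b i) (b j)) (b k) = a
      & forall i j k,
          (forall i' j' k' a, (i', j', k', a) \in P ->
             ~~ perm_eq [:: i; j; k] [:: i'; j'; k']) ->
          saa_form (saa_mul (b i) (b j)) (b k) = 0].

(* 1-based: y_ k is meant for 1 <= k <= 5. *)
Definition y_ (k : nat) : std_index 5 := inr (inord k.-1).

Definition P10_5_1 (F : fieldType) : presentation F 5 :=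
  [:: (y_ 1, y_ 2, y_ 3, 1); (y_ 1, y_ 4, y_ 5, 1)].

(* Main.v *)
Require Import Defs.
From mathcomp Require Import all_boot all_order all_algebra.
From mathcomp Require Import ring.
From HB Require Import structures.

Set Implicit Arguments.
Unset Strict Implicit.
Unset Printing Implicit Defensive.

Import GRing.Theory.

(** Write t(u, v, w) for (uv, w) and Z for the center of L. As the form is
    nondegenerate, Z is exactly the radical of the alternating trilinear form
    t, so t is the pullback of an alternating 3-form with zero radical on the
    5-dimensional space L / Z. Contraction with a volume form identifies the
    3-forms on a 5-dimensional space with its bivectors, and zero radical with
    maximal rank 4; hence there is only one such 3-form up to a change of
    basis, namely y1' y2' y3' + y1' y4' y5', where primes denote the dual basis
    and juxtaposition the exterior product.
    The proof finds the basis directly, over any field. Take a, b, c with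
    t(a, b, c) = 1 and complete them modulo Z by two vectors d, e chosen so that
    t vanishes on d, and on e, together with any two of a, b, c
    ([adapted_span]). Then
      t = a' b' c' + (A a' + B b' + C c') d' e',
    where A, B, C do not all vanish, for otherwise d would be central
    ([adapted_pivot]). The cyclic symmetry of t reduces to the case where A is
    nonzero, and there replacing b, c by b - (B/A) a, c - (C/A) a and
    rescaling e gives the normal form ([normal_form]).

    It remains to lift this basis of L / Z to a standard basis of L. Since Z is
    isotropic of half the dimension of L, it contains a family dual to the y_i,
    and the y_i can be made pairwise orthogonal by adding elements of Z
    ([lagrangian_completion]); this does not affect t. So every algebra with
    the required center is described by the presentation
    ([presented_of_center]). A presentation determines t on a standard basis,
    and t determines the product by nondegeneracy, which gives uniqueness
    ([isom_of_presentation]). For existence, the 3-form above is turned into a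
    product on the sum of a 5-dimensional space and its dual ([model]). *)

(** * The alternating trilinear form of a symplectic alternating algebra *)

Section Trilinear.

Local Open Scope ring_scope.

Variables (F : fieldType) (L : saa F).
Implicit Types (u v w z : L) (V : {vspace L}).

Definition tri u v w : F := saa_form (saa_mul u v) w.

Lemma form_swap u v : saa_form v u = - saa_form u v.
Proof.
apply/eqP; rewrite -addr_eq0; have := form_alternating (u + v).
by rewrite linearDl /= !linearDr /= !form_alternating add0r addr0 addrC => ->.
Qed.

Lemma tri_cyclic u v w : tri u v w = tri v w u.
Proof. exact: form_mul_cyclic. Qed.

Lemma triDr u v w w' : tri u v (w + w') = tri u v w + tri u v w'.
Proof. exact: linearDr. Qed.

Lemma triZr u v a w : tri u v (a *: w) = a * tri u v w.
Proof. exact: linearZr_LR. Qed.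

Lemma triNr u v w : tri u v (- w) = - tri u v w.
Proof. exact: linearNr. Qed.

Lemma triDl u u' v w : tri (u + u') v w = tri u v w + tri u' v w.
Proof. by rewrite !(tri_cyclic _ v) triDr. Qed.

Lemma triZl a u v w : tri (a *: u) v w = a * tri u v w.
Proof. by rewrite !(tri_cyclic _ v) triZr. Qed.

Lemma triNl u v w : tri (- u) v w = - tri u v w.
Proof. by rewrite !(tri_cyclic _ v) triNr. Qed.

Lemma triDm u v v' w : tri u (v + v') w = tri u v w + tri u v' w.
Proof. by rewrite !(tri_cyclic u) triDl. Qed.

Lemma triZm u a v w : tri u (a *: v) w = a * tri u v w.
Proof. by rewrite !(tri_cyclic u) triZl. Qed.

Lemma triNm u v w : tri u (- v) w = - tri u v w.
Proof. by rewrite !(tri_cyclic u) triNl. Qed.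

Lemma tri12 u w : tri u u w = 0.
Proof. by rewrite /tri mul_alternating linear0l. Qed.

Lemma tri23 u w : tri w u u = 0.
Proof. by rewrite tri_cyclic tri12. Qed.

Lemma tri13 u w : tri u w u = 0.
Proof. by rewrite tri_cyclic tri23. Qed.

Definition triE :=
  (triDl, triDm, triDr, triZl, triZm, triZr, triNl, triNm, triNr,
   tri12, tri23, tri13).

Lemma tri_swap12 u v w : tri v u w = - tri u v w.
Proof.
apply/eqP; rewrite -addr_eq0; have := tri12 (u + v) w.
by rewrite !triE add0r addr0 addrC => ->.
Qed.

Lemma tri_swap23 u v w : tri u w v = - tri u v w.
Proof. by rewrite tri_cyclic tri_swap12 -tri_cyclic. Qed.

Lemma tri_centerl z v w : z \in saa_center L -> tri z v w = 0.
Proof. by move=> /centerP zP; rewrite /tri zP linear0l. Qed.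

Lemma tri_centerm z u w : z \in saa_center L -> tri u z w = 0.
Proof. by move=> zZ; rewrite tri_cyclic tri_centerl. Qed.

Lemma tri_centerr z u v : z \in saa_center L -> tri u v z = 0.
Proof. by move=> zZ; rewrite -tri_cyclic tri_centerl. Qed.

Lemma form_eq0_span V (X : seq L) u :
  (V + <<X>>)%VS = fullv ->
  {in V, forall v, saa_form u v = 0} -> {in X, forall v, saa_form u v = 0} ->
  u = 0.
Proof.
move=> VX uV uX; apply: form_nondegenerate => v.
have : v \in (V + <<X>>)%VS by rewrite VX memvf.
case/memv_addP => w wV [w' /(@coord_span _ _ _ (in_tuple X)) -> ->].
rewrite linearDr /= uV // add0r linear_sumr big1 // => i _.
by rewrite linearZr_LR /= uX ?mulr0 // mem_nth.
Qed.

(** Both other arguments can be tested on [X] alone, because the trilinear form vanishes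
    as soon as one of its arguments is central. *)
Lemma center_span X u :
  (saa_center L + <<X>>)%VS = fullv ->
  {in X &, forall v w, tri u v w = 0} -> u \in saa_center L.
Proof.
move=> ZX uX; have mulX v : v \in X -> saa_mul u v = 0.
  move=> vX; apply: (form_eq0_span ZX) => w wP; last exact: uX.
  exact: tri_centerr.
apply/centerP => v; apply: (form_eq0_span ZX) => w wP; first exact: tri_centerr.
by have := tri_swap23 u w v; rewrite /tri (mulX w) // linear0l oppr0.
Qed.

End Trilinear.

(** * Standard bases and Lagrangian subspaces *)

Section StandardBasis.

Local Open Scope ring_scope.

Variables (F : fieldType) (L : saa F) (n : nat).
Implicit Types (b : std_index n -> L) (V : {vspace L}).

Lemma standard_basis_dim b : standard_basis b -> \dim (fullv : {vspace L}) = (n + n)%N.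
Proof.
by case=> bB _ _ _; rewrite (@size_basis _ _ _ _ (codom_tuple b)) // card_sum card_ord.
Qed.

Lemma sum_codom b (k : 'I_#|std_index n| -> F) :
  \sum_i k i *: (codom b)`_i = \sum_s k (enum_rank s) *: b s.
Proof.
rewrite [RHS](reindex (enum_val : 'I_#|std_index n| -> _)) /=; last first.
  by apply: onW_bij; exact: enum_val_bij.
apply: eq_bigr => i _; rewrite enum_valK; congr (_ *: _).
by rewrite nth_codom.
Qed.

Lemma standard_basis_coord b u :
  standard_basis b -> exists c : std_index n -> F, u = \sum_s c s *: b s.
Proof.
case=> bB _ _ _; exists (fun s => coord (codom_tuple b) (enum_rank s) u).
rewrite -(sum_codom b (fun i => coord (codom_tuple b) i u)).
exact: (@coord_basis _ _ _ _ (codom_tuple b) u bB (memvf u)).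
Qed.

(** Pairing a relation with [b (inr j)] isolates its coefficient at [inl j], and
    pairing it with [b (inl j)] the one at [inr j]. *)
Lemma pairing_free b :
  (forall i j, saa_form (b (inl i)) (b (inl j)) = 0) ->
  (forall i j, saa_form (b (inr i)) (b (inr j)) = 0) ->
  (forall i j, saa_form (b (inl i)) (b (inr j)) = (i == j)%:R) ->
  free (codom b).
Proof.
move=> bx byy bxy; apply: (introT (@freeP _ _ _ (codom_tuple b))) => k kb0 r.
have kb : \sum_(s : std_index n) k (enum_rank s) *: b s = 0.
  by rewrite -sum_codom; exact: kb0.
suff k0 s : k (enum_rank s) = 0 by rewrite -[r]enum_valK k0.
move: kb; rewrite big_sumType /=; case: s => j kb.
  have := congr1 (fun u => saa_form u (b (inr j))) kb.
  rewrite linearDl /= !linear_sumlz linear0l /= [X in _ + X]big1 => [|i _].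
    rewrite (bigD1 j) //= big1 => [|i ij]; rewrite linearZl_LR /= bxy.
      by rewrite eqxx mulr1 !addr0.
    by rewrite (negPf ij) mulr0.
  by rewrite linearZl_LR /= byy mulr0.
have := congr1 (fun u => saa_form (b (inl j)) u) kb.
rewrite linearDr /= !linear_sumr linear0r /= big1 => [|i _].
  rewrite (bigD1 j) //= big1 => [|i ij]; rewrite linearZr_LR /= bxy.
    by rewrite eqxx mulr1 addr0 add0r.
  by rewrite eq_sym (negPf ij) mulr0.
by rewrite linearZr_LR /= bx mulr0.
Qed.

(** Pairing with the [y j] embeds [V] into F^n: an element of the kernel is
    orthogonal to [V] by isotropy and to the [y j], hence to everything. As
    \dim V = n the embedding is onto, which yields the dual family [x]. The [y j]
    are then made orthogonal to each other by adding combinations of the [x i]. *)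
Lemma lagrangian_completion V (y : 'I_n -> L) :
  isotropic V -> \dim V = n -> (V + <<codom y>>)%VS = fullv ->
  exists x y' : 'I_n -> L,
    [/\ forall i, x i \in V, forall i, y' i - y i \in V
      & standard_basis
          (fun s : std_index n => match s with inl i => x i | inr i => y' i end)].
Proof.
move=> isoV dimV Vy.
pose p u : 'rV[F]_n := \row_j saa_form u (y j).
have p_lin : linear p.
  by move=> a u v; apply/rowP => j; rewrite !mxE linearDl /= linearZl_LR.
pose pM := GRing.isLinear.Build _ _ _ _ p p_lin.
pose pL : {linear _ -> _} := HB.pack p pM.
have kerp : (V :&: lker (linfun pL) = 0)%VS.
  apply/eqP; rewrite -subv0; apply/subvP => u /memv_capP[uV].
  rewrite memv_ker lfunE /= memv0 => /eqP pu0; apply/eqP.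
  apply: (form_eq0_span Vy) => v; first exact: isoV.
  by case/codomP => j ->; have /rowP/(_ j) := pu0; rewrite !mxE.
have imp : (linfun pL @: V = fullv)%VS.
  apply/eqP; rewrite eqEdim subvf limg_dim_eq // dimV dimvf.
  by rewrite /dim /= mul1n.
have /fin_all_exists[x xP] (i : 'I_n) : exists u, u \in V /\ p u = delta_mx 0 i.
  have : delta_mx 0 i \in (linfun pL @: V)%VS by rewrite imp memvf.
  by case/memv_imgP => u uV; rewrite lfunE; exists u.
have xV i : x i \in V by case: (xP i).
have xy i j : saa_form (x i) (y j) = (i == j)%:R.
  by case: (xP i) => _ /rowP/(_ j); rewrite !mxE eqxx eq_sym.
(* The matrix c satisfies c i j - c j i = (y i, y j). Half of the Gram matrix
   would do as well, but not in characteristic 2. *)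
pose c (i j : 'I_n) := if (i < j)%N then saa_form (y i) (y j) else 0.
pose y' j := y j + \sum_i c i j *: x i.
have yV j : y' j - y j \in V.
  by rewrite /y' addrC addKr; apply: memv_suml => i _; apply: memvZ.
have fxy i j : saa_form (x i) (y' j) = (i == j)%:R.
  by rewrite -[y' j](subrK (y j)) linearDr /= isoV // add0r xy.
have fyy i j : saa_form (y' i) (y' j) = 0.
  have -> : saa_form (y' i) (y' j) = saa_form (y i) (y j) - c i j + c j i.
    rewrite {1}/y' linearDl /= linear_sumlz /= (bigD1 j) //= big1 => [|k kj].
      rewrite linearZl_LR /= fxy eqxx mulr1 addr0; congr (_ + _).
      rewrite /y' linearDr /= linear_sumr /= (bigD1 i) //= big1 => [|k ki].
        by rewrite linearZr_LR /= (form_swap (x _)) xy eqxx mulrN1 addr0.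
      by rewrite linearZr_LR /= (form_swap (x _)) xy (negPf ki) oppr0 mulr0.
    by rewrite linearZl_LR /= fxy (negPf kj) mulr0.
  rewrite /c; case: ltngtP => [||/val_inj ->].
  - by rewrite subrr addr0.
  - by rewrite subr0 form_swap addNr.
  - by rewrite form_alternating subr0 addr0.
exists x, y'; split => //; split=> //; last by move=> i j; exact: isoV.
rewrite basisEfree subvf pairing_free //=; last by move=> i j; exact: isoV.
rewrite size_codom card_sum card_ord -Vy (leq_trans (dimv_add_leqif _ _)) //.
by rewrite dimV leq_add2l (leq_trans (dim_span _)) // size_codom card_ord.
Qed.

End StandardBasis.

(** * A presentation determines the algebra *)

(** The transpositions of adjacent entries generate all rearrangements. *)
Lemma perm_eq3_ind (T : eqType) (R : T -> T -> T -> Prop) i j k i' j' k' :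
  (forall u v w, R u v w -> R v u w) -> (forall u v w, R u v w -> R u w v) ->
  perm_eq [:: i; j; k] [:: i'; j'; k'] -> R i' j' k' -> R i j k.
Proof.
move=> R12 R23.
have perm2 (a b c d : T) :
    perm_eq [:: a; b] [:: c; d] -> a = c /\ b = d \/ a = d /\ b = c.
  move=> abcd; have := perm_mem abcd a; rewrite !inE eqxx /=.
  case/esym/orP => /eqP e; rewrite {}e in abcd *.
    move: abcd; rewrite perm_cons => /perm_mem/(_ b).
    by rewrite !inE eqxx => /esym/eqP ->; left.
  move: abcd; rewrite perm_sym (perm_catC [:: c] [:: d]) perm_sym perm_cons.
  by move=> /perm_mem/(_ b); rewrite !inE eqxx => /esym/eqP ->; right.
have head_case u v w : R u v w -> perm_eq [:: i; j; k] [:: u; v; w] -> i = u -> R i j k.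
  move=> Ruvw + iu; rewrite iu perm_cons => /perm2[][-> ->] //; exact: R23.
move=> ijk Rijk; have := perm_mem ijk i; rewrite !inE eqxx /=.
case/esym/or3P => /eqP ii'.
- exact: head_case Rijk ijk ii'.
- apply: head_case (R12 _ _ _ Rijk) _ ii'; apply: (perm_trans ijk).
  by apply/permP => p /=; rewrite addnCA.
- apply: head_case (R12 _ _ _ (R23 _ _ _ Rijk)) _ ii'; apply: (perm_trans ijk).
  by apply/permP => p /=; rewrite !addn0 addnA addnC.
Qed.

Section Isomorphism.

Local Open Scope ring_scope.

Variables (F : fieldType) (n : nat).

Lemma standard_basis_form (L M : saa F)
    (b : std_index n -> L) (b' : std_index n -> M) s t :
  standard_basis b -> standard_basis b' ->
  saa_form (b s) (b t) = saa_form (b' s) (b' t).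
Proof.
case=> _ bx byy bxy [_ b'x b'y b'xy]; case: s t => i [] j.
- by rewrite bx b'x.
- by rewrite bxy b'xy.
- by rewrite form_swap bxy form_swap b'xy.
- by rewrite byy b'y.
Qed.

Lemma tri_sum (L : saa F) (I : finType) (b : I -> L) (c d e : I -> F) :
  tri (\sum_s c s *: b s) (\sum_s d s *: b s) (\sum_s e s *: b s) =
  \sum_s \sum_t \sum_r c s * (d t * (e r * tri (b s) (b t) (b r))).
Proof.
have suml (a : I -> F) v w :
    tri (\sum_s a s *: b s) v w = \sum_s a s * tri (b s) v w.
  rewrite /tri !linear_sumlz; apply: eq_bigr => s _.
  by rewrite linearZl_LR -[LHS]/(saa_form _ _) linearZl_LR.
rewrite suml; apply: eq_bigr => s _; rewrite tri_cyclic suml mulr_sumr.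
apply: eq_bigr => t _; rewrite tri_cyclic suml !mulr_sumr.
by apply: eq_bigr => r _; rewrite tri_cyclic.
Qed.

(** The linear map sending [b] to [b'] is compatible with the forms and the
    trilinear forms; it is then compatible with the products, since a product
    uv is determined by the values (uv, w). *)
Lemma isom_of_tri (L M : saa F) (b : std_index n -> L) (b' : std_index n -> M) :
  standard_basis b -> standard_basis b' ->
  (forall s t r, tri (b s) (b t) (b r) = tri (b' s) (b' t) (b' r)) ->
  saa_isom L M.
Proof.
move=> bB b'B btri.
have [f fb] : exists f : 'Hom(L, M), forall s, f (b s) = b' s.
  have [g gP] := linear_of_free (codom b) (codom b').
  have [/basis_free/gP gb _ _ _] := bB.
  exists (linfun g) => s; rewrite lfunE /=; move: gb; rewrite !size_codom.
  move=> /(_ erefl)/(congr1 (nth 0 ^~ (enum_rank s))).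
  by rewrite (nth_map 0) ?size_codom ?ltn_ord // !nth_codom enum_rankK.
have fsum c : f (\sum_s c s *: b s) = \sum_s c s *: b' s.
  by rewrite linear_sum; apply: eq_bigr => s _; rewrite linearZ /= fb.
have fform u v : saa_form (f u) (f v) = saa_form u v.
  have [[c ->] [d ->]] := (standard_basis_coord u bB, standard_basis_coord v bB).
  rewrite !fsum !linear_sumlz; apply: eq_bigr => s _; rewrite !linear_sumr.
  apply: eq_bigr => t _; rewrite !linearZl_LR !linearZr_LR /=.
  by rewrite (standard_basis_form s t b'B bB).
have ftri u v w : tri (f u) (f v) (f w) = tri u v w.
  have [[c ->] [d ->]] := (standard_basis_coord u bB, standard_basis_coord v bB).
  have [e ->] := standard_basis_coord w bB; rewrite !fsum !tri_sum.
  by do 3![apply: eq_bigr => ? _]; rewrite btri.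
have fker : lker f = 0%VS.
  apply/eqP; rewrite -subv0; apply/subvP => u; rewrite memv_ker memv0 => /eqP fu0.
  by apply/eqP; apply: form_nondegenerate => v; rewrite -fform fu0 linear0l.
have fim : limg f = fullv.
  apply/eqP; rewrite eqEdim subvf limg_dim_eq ?fker ?capv0 //=.
  by apply: eq_leq; rewrite (standard_basis_dim b'B) (standard_basis_dim bB).
have fK : cancel f^-1%VF f by move=> u; rewrite limg_lfunVK // fim memvf.
exists f; split; last exact: fform.
  by exists f^-1%VF => //; apply: lker0_lfunK; rewrite fker.
move=> u v; apply/eqP; rewrite -subr_eq0; apply/eqP.
apply: form_nondegenerate => w; rewrite -[w]fK linearBl /= fform.
rewrite -/(tri u v _) -/(tri (f u) (f v) _).
by rewrite ftri subrr.
Qed.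

Lemma isom_of_presentation (L M : saa F) (P : presentation F n) :
  described_by L P -> described_by M P -> saa_isom L M.
Proof.
case=> b [bB bP b0] [b' [b'B b'P b'0]]; apply: (isom_of_tri bB b'B) => i j k.
pose reorders (q : std_index n * std_index n * std_index n * F) :=
  perm_eq [:: i; j; k] [:: q.1.1.1; q.1.1.2; q.1.2].
have [|/hasPn noP] := boolP (has reorders P).
  case/hasP => -[[[i' j'] k'] a] /= qP ijk.
  pose R s t r := tri (b s) (b t) (b r) = tri (b' s) (b' t) (b' r).
  apply: (perm_eq3_ind (R := R) _ _ ijk); rewrite /R.
  - by move=> s t r e; rewrite (tri_swap12 (b s)) (tri_swap12 (b' s)) e.
  - by move=> s t r e; rewrite (tri_swap23 _ (b t)) (tri_swap23 _ (b' t)) e.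
  - by rewrite /tri (bP _ _ _ _ qP) (b'P _ _ _ _ qP).
by rewrite /tri b0 ?b'0 // => i' j' k' a /noP.
Qed.

End Isomorphism.

(** * Normal form of the trilinear form modulo the center *)

(** Reduces a statement about an alternating trilinear form on basis vectors to
    strictly increasing indices. *)
Lemma sorted3_ind (n : nat) (R : 'I_n -> 'I_n -> 'I_n -> Prop) :
  (forall i j k, R i j k -> R j i k) -> (forall i j k, R i j k -> R i k j) ->
  (forall i k, R i i k) -> (forall i j k : 'I_n, i < j < k -> R i j k) ->
  forall i j k, R i j k.
Proof.
move=> R12 R23 Rd Rlt.
have Rle (i j k : 'I_n) : i <= j -> j <= k -> R i j k.
  rewrite leq_eqVlt => /predU1P[/val_inj -> _|ij]; first exact: Rd.
  rewrite leq_eqVlt => /predU1P[/val_inj ->|jk]; first by apply/R12/R23/Rd.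
  by apply: Rlt; rewrite ij.
move=> i j k.
have [ij|/ltnW ji] := leqP i j; have [jk|/ltnW kj] := leqP j k.
- exact: Rle.
- have [ik|/ltnW ki] := leqP i k; first exact/R23/Rle.
  exact/R23/R12/Rle.
- have [ik|/ltnW ki] := leqP i k; first exact/R12/Rle.
  exact/R12/R23/Rle.
- exact/R12/R23/R12/Rle.
Qed.

Section NormalForm.

Local Open Scope ring_scope.

Variables (F : fieldType) (L : saa F).
Implicit Types (a b c d e u v w : L) (V : {vspace L}) (X Y : seq L).

Local Notation Z := (saa_center L).

Lemma nonabelian_tri : saa_center L != fullv -> exists a b c : L, tri a b c = 1.
Proof.
rewrite eqEsubv subvf => /subvPn[a _ aZ].
pose X : seq L := vbasis fullv.
have [/hasP[b _ /hasP[c _ abc]]|abX] :=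
    boolP (has (fun b => has (fun c => tri a b c != 0) X) X).
  by exists a, b, ((tri a b c)^-1 *: c); rewrite triZr mulVf.
case/negP: aZ; apply: (@center_span _ _ X) => [|b c bX cX].
  by rewrite (span_basis (vbasisP fullv)) addvf.
apply/eqP; apply: contraNT abX => abc.
by apply/hasP; exists b => //; apply/hasP; exists c.
Qed.

(** Evaluating t with two of the slots of t(a, b, c) left unchanged isolates
    each coefficient. *)
Lemma tri1_lin_indep a b c (p q r : F) :
  tri a b c = 1 -> p *: a + q *: b + r *: c \in Z -> [/\ p = 0, q = 0 & r = 0].
Proof.
move=> abc kZ; split.
- by have := tri_centerl b c kZ; rewrite !triE abc mulr1 !mulr0 !addr0.
- by have := tri_centerm a c kZ; rewrite !triE abc mulr1 !mulr0 add0r addr0.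
- by have := tri_centerr a b kZ; rewrite !triE abc mulr1 !mulr0 !add0r.
Qed.

Lemma complete_triple a b c :
  \dim (fullv : {vspace L}) = (\dim Z + 5)%N -> tri a b c = 1 ->
  exists d e, (Z + <<[:: a; b; c; d; e]>>)%VS = fullv.
Proof.
move=> dimL abc; pose S : {vspace L} := <<[:: a; b; c]>>%VS.
have k0P (k : 'I_3 -> F) : \sum_i k i *: [tuple a; b; c]`_i \in Z -> forall i, k i = 0.
  rewrite !big_ord_recl big_ord0 /= addr0 addrA => /(tri1_lin_indep abc)[k0 k1 k2].
  case=> -[|[|[|//]]] ltm; [rewrite -[RHS]k0|rewrite -[RHS]k1|rewrite -[RHS]k2];
  by congr (k _); apply: val_inj.
have dimS : \dim S = 3.
  apply/eqP; apply: (introT (@freeP _ _ _ [tuple a; b; c])) => k k0.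
  by apply: k0P; rewrite k0 mem0v.
have ZS0 : (Z :&: S = 0)%VS.
  apply/eqP; rewrite -subv0; apply/subvP => u /memv_capP[uZ uS].
  have uE := coord_span (X := [tuple a; b; c]) uS.
  rewrite uE in uZ; rewrite memv0 uE; apply/eqP; apply: big1 => i _.
  by rewrite (k0P _ uZ) scale0r.
pose C : {vspace L} := (Z + S)^C%VS.
have dimC : \dim C = 2.
  by rewrite dimv_compl dimv_disjoint_sum // dimS dimL subnDl.
have [d [e de]] : exists d e, vbasis C = [:: d; e] :> seq L.
  case: (tval (vbasis C)) (size_tuple (vbasis C)); rewrite dimC.
    by [].
  by move=> d [|e []] // _; exists d, e.
exists d, e; rewrite -(addv_complf (Z + S)) -/C -(span_basis (vbasisP C)) de.
by rewrite -addvA -span_cat.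
Qed.

(** When t(a, b, c) = 1, L is the direct sum of the span of a, b, c and of the
    common kernel of t(a, b, -), t(a, c, -) and t(b, c, -). This is the component
    of [w] in the former. *)
Definition tri_part a b c w := tri b c w *: a - tri a c w *: b + tri a b w *: c.

Lemma tri_part_sub a b c w (w' := w - tri_part a b c w) :
  tri a b c = 1 -> [/\ tri a b w' = 0, tri a c w' = 0 & tri b c w' = 0].
Proof.
move=> abc; have acb : tri a c b = -1 by rewrite tri_swap23 abc.
have bca : tri b c a = 1 by rewrite -tri_cyclic.
by rewrite /w' /tri_part !triE abc acb bca; split; ring.
Qed.

Lemma span_full_trans V X Y :
  (V + <<X>>)%VS = fullv -> {in X, forall x, x \in (V + <<Y>>)%VS} ->
  (V + <<Y>>)%VS = fullv.
Proof.
move=> VX XY; apply/eqP; rewrite eqEsubv subvf -VX subv_add addvSl; exact/span_subvP.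
Qed.

Lemma adapted_span :
  \dim (fullv : {vspace L}) = (\dim Z + 5)%N ->
  exists a b c d e,
    [/\ (Z + <<[:: a; b; c; d; e]>>)%VS = fullv, tri a b c = 1,
      [/\ tri a b d = 0, tri a c d = 0 & tri b c d = 0]
    & [/\ tri a b e = 0, tri a c e = 0 & tri b c e = 0]].
Proof.
move=> dimL; have [|a [b [c abc]]] := nonabelian_tri.
  apply/eqP => Zf; move: dimL; rewrite Zf => /eqP.
  by rewrite -{1}[\dim _]addn0 eqn_add2l.
have [d [e Zabc]] := complete_triple dimL abc.
pose d' := d - tri_part a b c d; pose e' := e - tri_part a b c e.
exists a, b, c, d', e'; split; [|exact: abc|exact: tri_part_sub|exact: tri_part_sub].
apply: span_full_trans Zabc _; set W := (Z + _)%VS.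
have memW w : w \in [:: a; b; c; d'; e'] -> w \in W.
  by move=> wX; rewrite (subvP (addvSr _ _)) // memv_span.
have [aW bW cW] : [/\ a \in W, b \in W & c \in W].
  by split; apply: memW; rewrite !inE eqxx ?orbT.
have partW w : tri_part a b c w \in W by rewrite memvD ?memvB ?memvZ.
move=> w; rewrite !inE => /or4P[|||/orP[]]/eqP-> //.
- by rewrite -(subrK (tri_part a b c d) d) memvD // memW // !inE eqxx ?orbT.
- by rewrite -(subrK (tri_part a b c e) e) memvD // memW // !inE eqxx ?orbT.
Qed.

(** If the three values vanished then t(d, -, -) would vanish on the spanning
    family. So d would be central, and a, b, c, e could not span a complement of
    dimension 5. *)
Lemma adapted_pivot a b c d e :
  \dim (fullv : {vspace L}) = (\dim Z + 5)%N ->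
  (Z + <<[:: a; b; c; d; e]>>)%VS = fullv ->
  [/\ tri a b d = 0, tri a c d = 0 & tri b c d = 0] ->
  [|| tri a d e != 0, tri b d e != 0 | tri c d e != 0].
Proof.
move=> dimL Zabc [abd acd bcd]; rewrite -!negb_and; apply/negP => /and3P[].
move=> /eqP ade /eqP bde /eqP cde.
have dZ : d \in Z.
  apply: (center_span Zabc) => v w vX wX; rewrite tri_cyclic.
  have swap x y : tri x y d = 0 -> tri y x d = 0.
    by move=> xy; rewrite tri_swap12 xy oppr0.
  have aed : tri a e d = 0 by rewrite tri_swap23 ade oppr0.
  have bed : tri b e d = 0 by rewrite tri_swap23 bde oppr0.
  have ced : tri c e d = 0 by rewrite tri_swap23 cde oppr0.
  move: vX wX; rewrite !inE.
  by do 2![case/or4P => [|||/orP[]]/eqP->]; rewrite ?triE //; apply: swap; rewrite ?triE.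
have : (fullv <= Z + <<[:: a; b; c; e]>>)%VS.
  rewrite -Zabc subv_add addvSl; apply/span_subvP => w wX.
  have [->|wd] := eqVneq w d; first by rewrite (subvP (addvSl _ _)).
  rewrite (subvP (addvSr _ _)) // memv_span //.
  by move: wX; rewrite !inE (negPf wd) /=.
move=> /dimvS; rewrite dimL leqNgt; apply/negP; rewrite negbK.
apply: leq_ltn_trans (dimv_add_leqif _ _) _.
by rewrite ltn_add2l (leq_ltn_trans (dim_span _)).
Qed.

(** With A, B, C the values of t at (a, d, e), (b, d, e), (c, d, e), we have
    t = a' b' c' + (A a' + B b' + C c') d' e' in the dual basis, and the first
    factor of the second term is A times the first element of the basis dual to
    a, b - (B/A) a, c - (C/A) a, d, e. *)
Lemma normal_form_pivot a b c d e :
  (Z + <<[:: a; b; c; d; e]>>)%VS = fullv -> tri a b c = 1 ->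
  [/\ tri a b d = 0, tri a c d = 0 & tri b c d = 0] ->
  [/\ tri a b e = 0, tri a c e = 0 & tri b c e = 0] ->
  tri a d e != 0 ->
  exists2 y : 'I_5 -> L, (Z + <<codom y>>)%VS = fullv &
    forall i j k : 'I_5, (i < j < k)%N ->
      tri (y i) (y j) (y k) =
      ((i : nat, j : nat, k : nat) \in [:: (0, 1, 2); (0, 3, 4)]%N)%:R.
Proof.
move=> Zabc abc [abd acd bcd] [abe ace bce] ade.
pose A := tri a d e.
pose s := [:: a; b - (tri b d e / A) *: a; c - (tri c d e / A) *: a; d; A^-1 *: e].
exists (fun i : 'I_5 => s`_i); last first.
  have bad : tri b a d = 0 by rewrite tri_swap12 abd oppr0.
  have bae : tri b a e = 0 by rewrite tri_swap12 abe oppr0.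
  case=> -[|[|[|[|[|//]]]]] ? [] [|[|[|[|[|//]]]]] ? [] [|[|[|[|[|//]]]]] ? //= _;
  rewrite ?inE /= !triE ?abc ?abd ?acd ?bcd ?abe ?ace ?bce ?bad ?bae -/A; by field.
apply: span_full_trans Zabc _; set W := (Z + _)%VS.
have memW w : w \in s -> w \in W.
  move=> ws; rewrite (subvP (addvSr _ _)) // memv_span //.
  case/(nthP 0): ws => i lti <-; by apply/codomP; exists (Ordinal lti).
have aW : a \in W by apply: memW; rewrite /s !inE eqxx.
move=> w; rewrite !inE => /or4P[|||/orP[]]/eqP->; first exact: aW.
- rewrite -(subrK ((tri b d e / A) *: a) b) memvD ?memvZ // memW // /s !inE eqxx ?orbT //.
- rewrite -(subrK ((tri c d e / A) *: a) c) memvD ?memvZ // memW // /s !inE eqxx ?orbT //.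
- by rewrite memW // /s !inE eqxx !orbT.
- by rewrite -(scalerKV ade e) memvZ // memW // /s !inE eqxx !orbT.
Qed.

(** The hypotheses on a, b, c are invariant under cyclic permutation, so any of
    the three possible pivots can be moved to the first place. *)
Lemma normal_form :
  \dim (fullv : {vspace L}) = (\dim Z + 5)%N ->
  exists2 y : 'I_5 -> L, (Z + <<codom y>>)%VS = fullv &
    forall i j k : 'I_5, (i < j < k)%N ->
      tri (y i) (y j) (y k) =
      ((i : nat, j : nat, k : nat) \in [:: (0, 1, 2); (0, 3, 4)]%N)%:R.
Proof.
move=> dimL; have [a [b [c [d [e [Zabc abc dP eP]]]]]] := adapted_span dimL.
have cycS x y z : <<[:: x; y; z; d; e]>>%VS = <<[:: y; z; x; d; e]>>%VS.
  apply: eq_span => w; rewrite !inE; do !case: (w == _) => //.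
have cyc x y z v : [/\ tri x y v = 0, tri x z v = 0 & tri y z v = 0] ->
    [/\ tri y z v = 0, tri y x v = 0 & tri z x v = 0].
  by case=> xy xz yz; split=> //; rewrite tri_swap12 ?xy ?xz oppr0.
case/or3P: (adapted_pivot dimL Zabc dP) => piv.
- exact: normal_form_pivot Zabc abc dP eP piv.
- apply: (@normal_form_pivot b c a d e) => //; try exact: cyc.
    by rewrite -cycS.
  by rewrite -tri_cyclic.
- apply: (@normal_form_pivot c a b d e) => //; try exact: (cyc _ _ _ _ (cyc _ _ _ _ _)).
    by rewrite -2!cycS.
  by rewrite tri_cyclic.
Qed.

(** The standard basis given by the Lagrangian subspace Z has its first half
    central, where t vanishes, and its second half congruent modulo Z to a
    family in normal form. *)
Lemma presented_of_center :
  \dim (fullv : {vspace L}) = 10%N -> isotropic Z -> \dim Z = 5%N ->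
  described_by L (P10_5_1 F).
Proof.
move=> dimL isoZ dimZ.
have [|y Zy yP] := normal_form; first by rewrite dimL dimZ.
have [x [y' [xZ yZ b_std]]] := lagrangian_completion isoZ dimZ Zy.
pose b (s : std_index 5) := match s with inl i => x i | inr i => y' i end.
have triy i j k : tri (y' i) (y' j) (y' k) = tri (y i) (y j) (y k).
  have yE l : exists2 z, z \in Z & y' l = z + y l.
    by exists (y' l - y l); rewrite ?subrK.
  have [[zi ziZ ->] [zj zjZ ->] [zk zkZ ->]] := And3 (yE i) (yE j) (yE k).
  rewrite !triDl !triDm !triDr !(tri_centerl _ _ ziZ) !(tri_centerm _ _ zjZ).
  by rewrite !(tri_centerr _ _ zkZ) !add0r.
have triyP i j k lt := etrans (triy i j k) (yP i j k lt).
exists b; split=> //.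
  move=> i j k a; rewrite !inE => /orP[]/eqP[-> -> -> ->]; rewrite -/(tri _ _ _) /=;
  by rewrite triyP /= !inordK.
case=> [i|i] j k; first by move=> _; exact: (tri_centerl _ _ (xZ i)).
case: j => [j|j]; first by move=> _; exact: (tri_centerm _ _ (xZ j)).
case: k => [k|k]; first by move=> _; exact: (tri_centerr _ _ (xZ k)).
rewrite -/(tri _ _ _) /=; move: i j k; apply: sorted3_ind.
- move=> i j k IH ijk; rewrite tri_swap12 IH ?oppr0 // => i' j' k' a /ijk.
  by rewrite (perm_catCA [:: _] [:: _] [:: _]).
- move=> i j k IH ijk; rewrite tri_swap23 IH ?oppr0 // => i' j' k' a /ijk.
  by rewrite (perm_catAC [:: _] [:: _] [:: _]).
- by move=> i k _; exact: tri12.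
move=> i j k ijk noP; rewrite triyP //.
have [|//] := boolP (_ \in _).
have inrE (l : 'I_5) (m : nat) : (l : nat) = m -> inr l = y_ m.+1.
  by move=> <-; rewrite /y_ inord_val.
rewrite !inE => /orP[]/eqP[/inrE iE /inrE jE /inrE kE].
  by have /negP[] := noP (y_ 1) (y_ 2) (y_ 3) 1 (mem_head _ _); rewrite iE jE kE.
have /negP[] : ~~ perm_eq [:: inr i; inr j; inr k] [:: y_ 1; y_ 4; y_ 5].
  by apply: (noP _ _ _ 1); rewrite !inE eqxx orbT.
by rewrite iE jE kE.
Qed.

End NormalForm.

(** * The algebra built from the normal form *)

Section Model.

Local Open Scope ring_scope.

Variable F : fieldType.

Local Notation R5 := 'rV[F]_5.
Local Notation V := (R5 * R5)%type.
Implicit Types (p q r : R5) (u v w : V).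

Local Notation o k := (@Ordinal 5 k isT).

(** The determinant of the columns i, j, k of the matrix with rows p, q, r. It is
    expanded so that identities between such minors are polynomial identities in
    the entries. *)
Definition minor3 (i j k : 'I_5) p q r : F :=
  p 0 i * (q 0 j * r 0 k - q 0 k * r 0 j)
  + p 0 j * (q 0 k * r 0 i - q 0 i * r 0 k)
  + p 0 k * (q 0 i * r 0 j - q 0 j * r 0 i).

Definition model_tri p q r :=
  minor3 (o 0) (o 1) (o 2) p q r + minor3 (o 0) (o 3) (o 4) p q r.

Definition dot p q : F := \sum_i p 0 i * q 0 i.

Definition model_form u v : F := dot u.1 v.2 - dot v.1 u.2.

(** The first summand is the dual of the second, where u v is the functional
    t(u, v, -); its coordinates are the values on the unit vectors. *)
Definition model_mul u v : V := (\row_k model_tri u.2 v.2 (delta_mx 0 k), 0).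

Lemma dotC p q : dot p q = dot q p.
Proof. by apply: eq_bigr => i _; rewrite mulrC. Qed.

Lemma dotPl a p q r : dot (a *: p + q) r = a * dot p r + dot q r.
Proof.
rewrite mulr_sumr -big_split; apply: eq_bigr => i _.
by rewrite !mxE mulrDl mulrA.
Qed.

Lemma dot_delta p i : dot p (delta_mx 0 i) = p 0 i.
Proof.
rewrite /dot (bigD1 i) //= big1 => [|j ji]; rewrite !mxE !eqxx ?(negPf ji) ?mulr0 //=.
by rewrite mulr1 addr0.
Qed.

Lemma dot0l p : dot 0 p = 0.
Proof. by apply: big1 => i _; rewrite mxE mul0r. Qed.

Lemma minor3_sum i j l p q r :
  \sum_k minor3 i j l p q (delta_mx 0 k) * r 0 k = minor3 i j l p q r.
Proof.
have delta_sum m : \sum_k (delta_mx 0 k : R5) 0 m * r 0 k = r 0 m.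
  rewrite -[RHS]dot_delta dotC; apply: eq_bigr => k _.
  by rewrite !mxE eq_sym.
rewrite /minor3 -!delta_sum !mulr_sumr -!sumrB !mulr_sumr -!big_split /=.
by apply: eq_bigr => k _; ring.
Qed.

Lemma dot_model_tri p q r :
  dot (\row_k model_tri p q (delta_mx 0 k)) r = model_tri p q r.
Proof.
rewrite /model_tri -!minor3_sum -big_split; apply: eq_bigr => k _.
by rewrite mxE mulrDl.
Qed.

Lemma model_form_bilinear :
  bilinear_for
    (GRing.Scale.Law.clone _ _ *%R _) (GRing.Scale.Law.clone _ _ *%R _) model_form.
Proof.
split=> [w|w] a u v; rewrite /model_form /=.
  by rewrite dotPl !(dotC w.1) dotPl; ring.
by rewrite dotPl !(dotC w.1) dotPl; ring.
Qed.

HB.instance Definition _ :=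
  bilinear_isBilinear.Build F V V F _ _ model_form model_form_bilinear.

Lemma model_mul_bilinear :
  bilinear_for
    (GRing.Scale.Law.clone _ _ *:%R _) (GRing.Scale.Law.clone _ _ *:%R _) model_mul.
Proof.
split=> [w|w] a u v; rewrite /model_mul; congr (_, _) => /=; rewrite ?scaler0 ?addr0 //.
  by apply/rowP => k; rewrite /model_tri /minor3 !mxE; ring.
by apply/rowP => k; rewrite /model_tri /minor3 !mxE; ring.
Qed.

HB.instance Definition _ :=
  bilinear_isBilinear.Build F V V V _ _ model_mul model_mul_bilinear.

Lemma model_form_alternating u : model_form u u = 0.
Proof. exact: subrr. Qed.

Lemma model_form_nondegenerate u : (forall v, model_form u v = 0) -> u = 0.
Proof.
move=> u0; rewrite [u]surjective_pairing; congr (_, _); apply/rowP => i; rewrite mxE.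
  by have := u0 (0, delta_mx 0 i); rewrite /model_form /= dot_delta dot0l subr0.
have := u0 (delta_mx 0 i, 0); rewrite /model_form /= (dotC u.1) dot0l sub0r dotC.
by rewrite dot_delta => /eqP; rewrite oppr_eq0 => /eqP.
Qed.

Lemma model_mul_alternating u : model_mul u u = 0.
Proof.
congr (_, _); apply/rowP => k; rewrite /model_tri /minor3 !mxE; ring.
Qed.

Lemma model_form_mul u v w : model_form (model_mul u v) w = model_tri u.2 v.2 w.2.
Proof. by rewrite /model_form /= dot_model_tri dotC dot0l subr0. Qed.

Lemma model_form_mul_cyclic u v w :
  model_form (model_mul u v) w = model_form (model_mul v w) u.
Proof. by rewrite !model_form_mul /model_tri /minor3; ring. Qed.

Definition model : saa F :=
  @Saa F V model_form model_mul model_form_alternating model_form_nondegenerate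
    model_mul_alternating model_form_mul_cyclic.

Lemma model_center : saa_center model = lker (linfun (snd : V -> R5)).
Proof.
apply/vspaceP => u; rewrite memv_ker lfunE /=.
apply/(@centerP _ model u)/eqP => [uP | u20 v]; last first.
  congr (_, _); apply/rowP => k; rewrite /model_tri /minor3 u20 !mxE; ring.
have u2 p q : model_tri u.2 p q = 0.
  rewrite -[LHS](model_form_mul u (0, p) (0, q)).
  by rewrite -[model_mul _ _]/(saa_mul (u : model) (0, p)) uP; exact: linear0l.
pose e k : R5 := delta_mx 0 k.
(* The i-th of these five values of the 3-form is the i-th coordinate of u.2. *)
have := And5 (u2 (e (o 1)) (e (o 2))) (u2 (e (o 2)) (e (o 0))) (u2 (e (o 0)) (e (o 1)))
  (u2 (e (o 4)) (e (o 0))) (u2 (e (o 0)) (e (o 3))).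
rewrite /model_tri /minor3 !mxE /= !(oppr0, mulr0, mul0r, mulr1, addr0, add0r).
case=> u0 u1 u20 u3 u4.
apply/rowP; case=> -[|[|[|[|[|//]]]]] ltk; rewrite mxE;
  [rewrite -[RHS]u0|rewrite -[RHS]u1|rewrite -[RHS]u20|rewrite -[RHS]u3|rewrite -[RHS]u4];
  by congr (u.2 0 _); apply: val_inj.
Qed.

Lemma model_dim : \dim (fullv : {vspace model}) = 10%N.
Proof. by rewrite dimvf. Qed.

Lemma model_center_dim : \dim (saa_center model) = 5%N.
Proof.
rewrite model_center; have := limg_ker_dim (linfun (snd : V -> R5)) fullv.
rewrite capfv (_ : (linfun _ @: _)%VS = fullv).
  by rewrite !dimvf => /eqP; rewrite (eqn_add2r 5 _ 5) => /eqP.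
apply/eqP; rewrite eqEsubv subvf; apply/subvP => q _.
by apply/memv_imgP; exists (0, q); rewrite ?memvf // lfunE.
Qed.

Lemma model_center_snd u : u \in saa_center model -> u.2 = 0.
Proof. by rewrite model_center memv_ker lfunE => /eqP. Qed.

Lemma model_center_isotropic : isotropic (saa_center model).
Proof.
move=> u v /model_center_snd u0 /model_center_snd v0.
by rewrite /= /model_form u0 v0 !(dotC _ 0) !dot0l subrr.
Qed.

Lemma model_nilpotent : saa_nilpotent model.
Proof.
exists 2; apply/eqP; rewrite -subv0; apply/prodsP => u v.
have mulZ : (lpow model 1 <= saa_center model)%VS.
  by apply/prodsP => {}u {}v _ _; rewrite model_center memv_ker lfunE.
by move=> /(subvP mulZ)/centerP uP _; rewrite uP mem0v.
Qed.

End Model.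

Theorem proposition5p1 (F : fieldType) :
  exists L : saa F,
    [/\ [/\ saa_nilpotent L, \dim (fullv : {vspace L}) = 10,
            isotropic (saa_center L) & \dim (saa_center L) = 5],
        described_by L (P10_5_1 F)
      & forall M : saa F,
          saa_nilpotent M -> \dim (fullv : {vspace M}) = 10 ->
          isotropic (saa_center M) -> \dim (saa_center M) = 5 ->
          saa_isom L M].
Proof.
have modelP := presented_of_center (@model_dim F) (@model_center_isotropic F)
  (@model_center_dim F).
exists (model F); split=> //.
  split; [exact: model_nilpotent | exact: model_dim | exact: model_center_isotropic |].
  exact: model_center_dim.
move=> M _ dimM isoM dimZ.
exact: isom_of_presentation modelP (presented_of_center dimM isoM dimZ).
Qed.
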